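(* Let $(\mathfrak{g},\top_{\mathfrak g},[\,,])$ be a pre-locality Lie algebra, let $(A,\top_A)$ be a pre-locality algebra whose product $m_A:(A\times_\top A,\top_{A\times_\top A})\to(A,\top_A)$ is a locality map, and let $f:\mathfrak{g}\to A$ be a pre-locality Lie algebra morphism for the Lie bracket on $A$ defined as the commutator of the product. There is a unique pre-locality algebra morphism $\phi:(U_\top(\mathfrak g),\top_U)\to(A,\top_A)$ such that $f=\phi\circ\iota_{\mathfrak g}$, where $\iota_{\mathfrak g}:\mathfrak g\to U_\top(\mathfrak g)$ is the canonical (locality) map.
   Context: $\mathbb{K}$ is $\mathbb{R}$ or $\mathbb{C}$. A locality map is a map between sets with symmetric relations sending related pairs to related pairs. A pre-locality vector space is a vector space $V$ with a symmetric relation $\top\subset V\times V$, $(0,0)\in\top$. A locality linear map is a linear locality map. $U^\top=\{x: x\top u\ \forall u\in U\}$. $\mathbb{K}(X)$ is the free vector space on $X$. Bilinearity: for a pre-locality vector space $(A,\top)$, $A\times_\top A:=\top$; $I_{\rm bil}\subset\mathbb{K}(A\times A)$ is spanned by all $(a+b,x)-(a,x)-(b,x)$, $(a,x+y)-(a,x)-(a,y)$, $(ka,x)-k(a,x)$, $(a,kx)-k(a,x)$. A map on $A\times_\top A$ with values in a vector space is $\top_\times$-bilinear if its linear extension to $\mathbb{K}(A\times_\top A)$ vanishes on $I_{\rm bil}\cap\mathbb{K}(A\times_\top A)$. The relation $\top_{A\times_\top A}$ relates $(a,b)$ and $(a',b')$ iff $a\top a'$ and $b\top b'$; a $\top_\times$-bilinear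 map is locality $\top_\times$-bilinear if it is also a locality map for this relation. A (unital) pre-locality algebra $(A,\top,m,u)$ is a pre-locality vector space with a $\top_\times$-bilinear product $m:A\times_\top A\to A$ with $m(m(x,y),z)=m(x,m(y,z))$ for pairwise independent $x,y,z$ whenever both sides are defined, and a linear unit map $u:\mathbb{K}\to A$ with $u(\mathbb{K})\subset A^\top$ and $m(u(k),a)=ka=m(a,u(k))$. A pre-locality algebra morphism is a locality linear map $g$ with $g(m_1(x,y))=m_2(g(x),g(y))$ for all $x\top_1y$, preserving units. A pre-locality ideal of $A$ is a linear subspace $I$ with $m(I\times I^\top)\subset I$ and $m(I^\top\times I)\subset I$. A pre-locality Lie algebra is a triple $(\mathfrak g,\top_{\mathfrak g},[\,,])$ with $(\mathfrak g,\top_{\mathfrak g})$ a pre-locality vector space and $[\,,]:\top_{\mathfrak g}\to\mathfrak g$ an antisymmetric locality $\top_\times$-bilinear map, such that for every $U\subset\mathfrak g$ the bracket maps $(U^\top\times U^\top)\cap\top_{\mathfrak g}$ into $U^\top$, and $[[a,b],c]+[[c,a],b]+[[b,c],a]=0$ for pairwise independent $a,b,c$. A pre-locality Lie algebra morphism is a locality linear map with $f([x,y])=[f(x),f(y)]$ whenever $x\top y$. On $A$ the commutator bracket is $[x,y]=xy-yx$ for $x\top_A y$. Locality tensor algebra of a pre-locality vector space $(V,\top)$: for $n\ge1$, $V^{\times_\top n}=\{(x_1,\dots,x_n)\in V^n: x_i\top x_j\ \forall i\neq j\}$; $I_{{\rm mult},n}(V)\subset\mathbb{K}(V^n)$ is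 spanned by all $(\dots,a_i+b_i,\dots)-(\dots,a_i,\dots)-(\dots,b_i,\dots)$ and $(\dots,kx_i,\dots)-k(\dots,x_i,\dots)$; $V^{\otimes_\top n}=\mathbb{K}(V^{\times_\top n})/(I_{{\rm mult},n}(V)\cap\mathbb{K}(V^{\times_\top n}))$, $V^{\otimes_\top0}=\mathbb{K}$, $\mathcal{T}_\top(V)=\bigoplus_{n\ge0}V^{\otimes_\top n}$. Let $F(V)=\mathbb{K}\cdot1\oplus\bigoplus_{n\ge1}\mathbb{K}(V^{\times_\top n})$. Tuples $(x_i)$, $(y_j)$ are independent iff $x_i\top y_j$ for all $i,j$; $1$ is independent of every basis element; two elements of $F(V)$ are independent iff all basis elements occurring with nonzero coefficient in the first are independent of all those in the second. Two elements of $\mathcal{T}_\top(V)$ are $\top_\otimes$-related iff they have independent representatives in $F(V)$. The product is the tensor product restricted to $\top_\otimes$. Locality universal enveloping algebra: $J_\top(\mathfrak g)$ is the pre-locality ideal of $\mathcal{T}_\top(\mathfrak g)$ generated by all $a\otimes b-b\otimes a-[a,b]$ with $(a,b)\in\top_{\mathfrak g}$; $U_\top(\mathfrak g):=\mathcal{T}_\top(\mathfrak g)/J_\top(\mathfrak g)$, with the induced product and unit; $x\top_U y$ iff there are representatives $a\in x$, $b\in y$ in $\mathcal{T}_\top(\mathfrak g)$ with $a\top_\otimes b$. The map $\iota_{\mathfrak g}$ is the composition $\mathfrak g\to\mathcal{T}_\top(\mathfrak g)\to U_\top(\mathfrak g)$. *)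

(* Defs.v *)
From HB Require Import structures.
From mathcomp Require Import all_boot all_algebra finmap.
From mathcomp Require Import boolp classical_sets reals.
From mathcomp Require Import complex monalg.

Set Implicit Arguments.
Unset Strict Implicit.
Unset Printing Implicit Defensive.

Import GRing.Theory.

Local Open Scope ring_scope.
Local Open Scope classical_set_scope.

Variant base_field := RealField | ComplexField.

Definition scalars (R : realType) (k : base_field) : fieldType :=
  match k with RealField => R | ComplexField => complex R end.

(* {malg K[X]} is the free K-vector space on X. *)

Section Linear.
Context {K : fieldType}.

Definition subspace (V : lmodType K) (S : set V) : Prop := submod_closed [in S].

Definition span (V : lmodType K) (G : set V) : set V := smallest (@subspace V) G.

Definition linear_extension (X : choiceType) (V : lmodType K) (h : X -> V)
    (p : {malg K[X]}) : V :=
  \sum_(x <- msupp p) p@_x *: h x.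

Lemma subspaceP (V : lmodType K) (S : set V) :
  subspace S <-> S 0 /\ forall k u v, S u -> S v -> S (k *: u + v).
Proof.
split=> -[S0 SD]; split.
- exact: set_mem S0.
- by move=> k u v Su Sv; apply/set_mem/SD; apply/mem_set.
- exact: mem_set.
- by move=> k u v Su Sv; apply/mem_set/SD; apply/set_mem.
Qed.

Lemma smallest_subspace (V : lmodType K) (C : set V -> Prop) (G : set V) :
  (forall S, C S -> subspace S) -> subspace (smallest C G).
Proof.
move=> CS; apply/subspaceP; split=> [M [/CS/subspaceP[]//]|k u v Gu Gv M CM].
have [/CS/subspaceP[_ MD] _] := CM.
by apply: MD; [exact: Gu|exact: Gv].
Qed.

End Linear.

Section QuotientSpace.
Context {K : fieldType} {V : lmodType K} (S : submodClosed V).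

(* ssralg has no path from submodClosed to the zmodClosed that
   ring_quotient expects. *)
Definition as_zmod : {pred V} := fun x => x \in S.
HB.instance Definition _ :=
  GRing.isSubmodClosed.Build K V as_zmod (submodClosedP S).

Definition quotient_space : Type := Quotient.quot as_zmod.
HB.instance Definition _ := GRing.Zmodule.on quotient_space.

Definition quotient_proj (x : V) : quotient_space := \pi_(Quotient.quot as_zmod)%qT x.

Definition quotient_scale (k : K) (x : quotient_space) : quotient_space :=
  quotient_proj (k *: repr (x : Quotient.quot as_zmod)).

Lemma quotient_projP x y : quotient_proj x = quotient_proj y <-> x - y \in S.
Proof.
by rewrite -[x - y \in S]/(x - y \in as_zmod) Quotient.idealrBE; split=> /eqP.
Qed.

Lemma quotient_proj_surj (x : quotient_space) : exists y, quotient_proj y = x.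
Proof. by exists (repr (x : Quotient.quot as_zmod)); rewrite /quotient_proj reprK. Qed.

Lemma quotient_projD x y :
  quotient_proj (x + y) = quotient_proj x + quotient_proj y.
Proof. by rewrite /quotient_proj !piE. Qed.

Lemma quotient_projZ k x :
  quotient_scale k (quotient_proj x) = quotient_proj (k *: x).
Proof.
by apply/quotient_projP; rewrite -scalerBr rpredZ //; apply/quotient_projP;
  rewrite /quotient_proj reprK.
Qed.

Fact quotient_scaleA a b v :
  quotient_scale a (quotient_scale b v) = quotient_scale (a * b) v.
Proof. by have [x <-] := quotient_proj_surj v; rewrite !quotient_projZ scalerA. Qed.

Fact quotient_scale1 : left_id 1 quotient_scale.
Proof.
by move=> v; have [x <-] := quotient_proj_surj v; rewrite quotient_projZ scale1r.
Qed.

Fact quotient_scaleDr : right_distributive quotient_scale +%R.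
Proof.
move=> a u v; have [x <-] := quotient_proj_surj u.
have [y <-] := quotient_proj_surj v.
by rewrite -quotient_projD !quotient_projZ -quotient_projD scalerDr.
Qed.

Fact quotient_scaleDl v : {morph quotient_scale^~ v : a b / a + b}.
Proof.
move=> a b; have [x <-] := quotient_proj_surj v.
by rewrite !quotient_projZ -quotient_projD scalerDl.
Qed.

HB.instance Definition _ := GRing.Zmodule_isLmodule.Build K quotient_space
  quotient_scaleA quotient_scale1 quotient_scaleDr quotient_scaleDl.

End QuotientSpace.

Section PreLocality.
Context {K : fieldType}.

Definition is_prelocality_space (V : lmodType K) (top : V -> V -> Prop) : Prop :=
  (forall x y, top x y -> top y x) /\ top 0 0.

Definition polar (V : Type) (top : V -> V -> Prop) (U : set V) : set V :=
  [set x | forall u, U u -> top x u].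

Definition locality_map (V W : Type) (topV : V -> V -> Prop)
    (topW : W -> W -> Prop) (f : V -> W) : Prop :=
  forall x y, topV x y -> topW (f x) (f y).

Definition bilinear_relators (A : lmodType K) : set {malg K[(A * A)%type]} :=
  [set p | [\/ exists a b x, p = << (a + b, x) >> - << (a, x) >> - << (b, x) >>,
               exists a x y, p = << (a, x + y) >> - << (a, x) >> - << (a, y) >>,
               exists k a x, p = << (k *: a, x) >> - k *: << (a, x) >>
             | exists k a x, p = << (a, k *: x) >> - k *: << (a, x) >>]].

(* A map m defined on [top] is represented by an arbitrary total extension
   A -> A -> A: every clause about m below only evaluates it at pairs (x, y)
   with [top x y]. *)

Definition top_bilinear (A B : lmodType K) (top : A -> A -> Prop)
    (m : A -> A -> B) : Prop :=
  forall p : {malg K[(A * A)%type]},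
    span (@bilinear_relators A) p ->
    (forall ab, ab \in msupp p -> top ab.1 ab.2) ->
    linear_extension (fun ab => m ab.1 ab.2) p = 0.

Definition locality_product (A B : Type) (topA : A -> A -> Prop)
    (topB : B -> B -> Prop) (m : A -> A -> B) : Prop :=
  forall a b a' b', topA a b -> topA a' b' ->
    topA a a' -> topA b b' -> topB (m a b) (m a' b').

Record is_prelocality_algebra (A : lmodType K) (top : A -> A -> Prop)
    (m : A -> A -> A) (u : K -> A) : Prop := {
  prealg_space : is_prelocality_space top;
  prealg_bilinear : top_bilinear top m;
  prealg_assoc : forall x y z, top x y -> top x z -> top y z ->
    top (m x y) z -> top x (m y z) -> m (m x y) z = m x (m y z);
  prealg_unit_linear : linear (u : K^o -> A);
  prealg_unit_polar : forall k, polar top setT (u k);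
  prealg_mul1l : forall k a, m (u k) a = k *: a;
  prealg_mul1r : forall k a, m a (u k) = k *: a }.

Record is_prelocality_lie (g : lmodType K) (top : g -> g -> Prop)
    (br : g -> g -> g) : Prop := {
  prelie_space : is_prelocality_space top;
  prelie_antisym : forall x y, top x y -> br y x = - br x y;
  prelie_bilinear : top_bilinear top br;
  prelie_locality : locality_product top top br;
  prelie_polar : forall (U : set g) x y, polar top U x -> polar top U y ->
    top x y -> polar top U (br x y);
  prelie_jacobi : forall a b c, top a b -> top a c -> top b c ->
    br (br a b) c + br (br c a) b + br (br b c) a = 0 }.

Definition is_prelocality_lie_morphism (g h : lmodType K)
    (topg : g -> g -> Prop) (brg : g -> g -> g)
    (toph : h -> h -> Prop) (brh : h -> h -> h) (f : g -> h) : Prop :=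
  [/\ linear f, locality_map topg toph f
    & forall x y, topg x y -> f (brg x y) = brh (f x) (f y)].

Definition commutator (A : lmodType K) (m : A -> A -> A) (x y : A) : A :=
  m x y - m y x.

(* Partial products as ternary relations: [mul x y z] reads "z is a product of
   x and y".  On quotients the product is only given through independent
   representatives, see [quotient_mul]. *)

Definition product_graph (A : Type) (top : A -> A -> Prop) (m : A -> A -> A)
    (x y z : A) : Prop :=
  top x y /\ z = m x y.

Definition is_prelocality_ideal (A : lmodType K) (top : A -> A -> Prop)
    (mul : A -> A -> A -> Prop) (I : set A) : Prop :=
  subspace I /\
  forall x y z, I x -> polar top I y -> mul x y z \/ mul y x z -> I z.

Definition is_prelocality_algebra_morphism (A B : lmodType K)
    (topA : A -> A -> Prop) (mulA : A -> A -> A -> Prop) (uA : K -> A)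
    (topB : B -> B -> Prop) (mulB : B -> B -> B -> Prop) (uB : K -> B)
    (g : A -> B) : Prop :=
  [/\ linear g, locality_map topA topB g,
      forall x y z, mulA x y z -> mulB (g x) (g y) (g z)
    & forall k, g (uA k) = uB k].

Definition quotient_top (A Q : Type) (top : A -> A -> Prop) (pi : A -> Q)
    (x y : Q) : Prop :=
  exists a b, [/\ pi a = x, pi b = y & top a b].

Definition quotient_mul (A Q : Type) (mul : A -> A -> A -> Prop) (pi : A -> Q)
    (x y z : Q) : Prop :=
  exists a b c, [/\ pi a = x, pi b = y, pi c = z & mul a b c].

End PreLocality.

Section MonoidAlgebra.
Context {K : fieldType} {M : monomType}.

Lemma malg_ind (P : {malg K[M]} -> Prop) :
  P 0 -> (forall k w p, P p -> P (k *: << w >> + p)) -> forall p, P p.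
Proof.
move=> P0 PD p; rewrite (monalgE p).
elim: (enum_fset _) => [|w r IH]; first by rewrite big_nil.
rewrite big_cons; suff -> : << p@_w *g w >> = p@_w *: << w >> by apply: PD.
by apply/malgP => v; rewrite mcoeffZ !mcoeffU mulrnAr mulr1.
Qed.

Lemma malg_scalerAr k (p q : {malg K[M]}) : k *: (p * q) = p * (k *: q).
Proof.
have UE c w : c *: << w >> = << c *g w >> :> {malg K[M]}.
  by apply/malgP => v; rewrite mcoeffZ !mcoeffU mulrnAr mulr1.
elim/malg_ind: p => [|a s p IHp]; first by rewrite !mul0r scaler0.
rewrite !mulrDl scalerDr IHp; congr (_ + _).
elim/malg_ind: q {p IHp} => [|b t q IHq]; first by rewrite mulr0 !scaler0 mulr0.
rewrite mulrDr !scalerDr mulrDr IHq; congr (_ + _).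
rewrite scalerA !UE !malgM_def !fgmulUU.
by apply/malgP => v; rewrite mcoeffZ !mcoeffU mulrnAr mulrCA.
Qed.

End MonoidAlgebra.

Section TensorAlgebra.
Context {K : fieldType} {V : lmodType K} (top : V -> V -> Prop).

(* Direct sum over n >= 0 of the free spaces K(V^n): words on V are the basis,
   the empty word is 1, and the ring product is concatenation. *)
Local Notation words := {malg K[{fmonom V}]}.

Definition word (s : seq V) : words := << FMonom s >>.

Definition independent_tuple (s : seq V) : Prop :=
  forall i j, (i < size s)%N -> (j < size s)%N -> i <> j -> top s`_i s`_j.

Definition in_local_words : {pred words} :=
  fun p => `[< forall w, w \in msupp p -> independent_tuple w >].

Fact in_local_words_closed : submod_closed in_local_words.
Proof.
split=> [|k p q /asboolP Hp /asboolP Hq]; apply/asboolP=> w.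
  by rewrite msupp0.
move=> /(fsubsetP (msuppD_le _ _)); rewrite in_fsetU => /orP[|]; last exact: Hq.
by move=> /(fsubsetP (msuppZ_le _ _)); exact: Hp.
Qed.

HB.instance Definition _ :=
  GRing.isSubmodClosed.Build K words in_local_words in_local_words_closed.

(* F(V) *)
Definition local_words : Type := {p : words | p \in in_local_words}.
HB.instance Definition _ := [isSub of local_words for @sval _ _].
HB.instance Definition _ := [Choice of local_words by <:].
HB.instance Definition _ := [SubChoice_isSubLmodule of local_words by <:].

(* The span of these relators is the direct sum of the I_{mult,n}(V). *)
Definition multilinear_relators : set words :=
  [set p | (exists s t a b,
              p = word (s ++ (a + b) :: t) - word (s ++ a :: t)
                  - word (s ++ b :: t)) \/
           (exists s t k a,
              p = word (s ++ (k *: a) :: t) - k *: word (s ++ a :: t))].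

Definition in_multilinear : {pred local_words} :=
  fun p => `[< span multilinear_relators (\val p) >].

Fact in_multilinear_closed : submod_closed in_multilinear.
Proof.
have /subspaceP[S0 SD] : subspace (span multilinear_relators).
  exact: smallest_subspace.
split=> [|k p q /asboolP Hp /asboolP Hq]; apply/asboolP.
  by rewrite raddf0.
by rewrite -[\val _]/(k *: \val p + \val q); apply: SD.
Qed.

HB.instance Definition _ :=
  GRing.isSubmodClosed.Build K local_words in_multilinear in_multilinear_closed.

Definition tensor_algebra : lmodType K := quotient_space in_multilinear.

Definition tensor_proj (p : local_words) : tensor_algebra :=
  quotient_proj in_multilinear p.

Definition independent_words (p q : local_words) : Prop :=
  forall s t : {fmonom V}, s \in msupp (\val p) -> t \in msupp (\val q) ->
    forall x y, x \in (s : seq V) -> y \in (t : seq V) -> top x y.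

Definition tensor_top : tensor_algebra -> tensor_algebra -> Prop :=
  quotient_top independent_words tensor_proj.

(* The graph of a map defined on tensor_top: see tensor_mul_total and
   tensor_mul_uniq. *)
Definition tensor_mul : tensor_algebra -> tensor_algebra -> tensor_algebra -> Prop :=
  quotient_mul
    (fun p q r => independent_words p q /\ \val r = \val p * \val q) tensor_proj.

Fact word_local (s : seq V) : independent_tuple s -> word s \in in_local_words.
Proof.
move=> Hs; apply/asboolP=> w /(fsubsetP msuppU_le).
by rewrite in_fset1 => /eqP->.
Qed.

Definition local_word (s : seq V) (Hs : independent_tuple s) : local_words :=
  exist _ (word s) (word_local Hs).

Fact independent_tuple0 : independent_tuple [::]. Proof. by []. Qed.

Fact independent_tuple1 x : independent_tuple [:: x].
Proof. by case=> [|i] [|j]. Qed.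

Definition tensor_unit (k : K) : tensor_algebra :=
  k *: tensor_proj (local_word independent_tuple0).

Definition tensor_incl (x : V) : tensor_algebra :=
  tensor_proj (local_word (@independent_tuple1 x)).

Lemma wordM s t : word s * word t = word (s ++ t).
Proof.
rewrite /word malgM_def fgmulUU mulr1; congr << _ >>.
by apply/eqP; rewrite fmP fmM.
Qed.

Lemma span_multilinearM p q : span multilinear_relators p ->
  span multilinear_relators (q * p) /\ span multilinear_relators (p * q).
Proof.
have /subspaceP[S0 SD] : subspace (span multilinear_relators).
  exact: smallest_subspace.
have SG r : multilinear_relators r -> span multilinear_relators r.
  exact: sub_gen_smallest.
pose C := [set r | forall q, span multilinear_relators (q * r) /\
                             span multilinear_relators (r * q)].
suff sC : span multilinear_relators `<=` C by move=> /sC/(_ q).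
apply: smallest_sub; first apply/subspaceP; first split.
- by move=> r; rewrite mulr0 mul0r; split; exact: S0.
- move=> k u v Cu Cv r; have [u1 u2] := Cu r; have [v1 v2] := Cv r.
  rewrite mulrDl mulrDr -(scalerAl k u r) -(malg_scalerAr k r u).
  by split; [exact: SD u1 v1|exact: SD u2 v2].
move=> r Gr h; elim/(@malg_ind K {fmonom V}): h => [|k [u] h [h1 h2]].
  by rewrite mulr0 mul0r; split; exact: S0.
rewrite mulrDl mulrDr -(scalerAl k (word u) r) -(malg_scalerAr k r (word u)).
suff [g1 g2] : multilinear_relators (word u * r) /\
               multilinear_relators (r * word u).
  by split; [exact: SD (SG _ g1) h1|exact: SD (SG _ g2) h2].
case: Gr => [[s][t][a][b]|[s][t][c][a]] ->; split.
- left; exists (u ++ s), t, a, b.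
  by rewrite !mulrBr !wordM !catA.
- left; exists s, (t ++ u), a, b.
  by rewrite !mulrBl !wordM -!catA.
- right; exists (u ++ s), t, c, a.
  by rewrite mulrBr -(malg_scalerAr c (word u)) !wordM !catA.
- right; exists s, (t ++ u), c, a.
  by rewrite mulrBl -(scalerAl c _ (word u)) !wordM -!catA.
Qed.

Lemma tensor_mul_total x y : (forall a b, top a b -> top b a) ->
  tensor_top x y -> exists z, tensor_mul x y z.
Proof.
move=> top_sym [p [q [px qy pq]]].
suff Fpq : \val p * \val q \in in_local_words.
  pose r : local_words := exist (fun p => p \in in_local_words) _ Fpq.
  by exists (tensor_proj r), p, q, r; split=> //; split.
have /asboolP Fp := valP p; have /asboolP Fq := valP q.
apply/asboolP => _ /msuppM_le[s [t [sp tq ->]]].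
rewrite fmM => i j; rewrite size_cat !nth_cat => iL jL ij.
have addL n m : (n < size s + size t)%N -> (size s <= m)%N -> m = n ->
    (n - size s < size t)%N by move=> nL mL nm; rewrite ltn_subLR // -nm.
case: ltnP => is_; case: ltnP => js.
- exact: (Fp s).
- by apply: (pq s t) => //; apply: mem_nth => //; apply: addL js _.
- by apply/top_sym/(pq s t) => //; apply: mem_nth => //; apply: addL is_ _.
- apply: (Fq t) => //; [exact: addL is_ _|exact: addL js _|].
  by move=> /(congr1 (addn (size s))); rewrite !subnKC.
Qed.

Lemma tensor_mul_uniq x y z z' : tensor_mul x y z -> tensor_mul x y z' -> z = z'.
Proof.
move=> [p [q [r [px qy <- [_ rE]]]]] [p' [q' [r' [p'x q'y <- [_ r'E]]]]].
have /quotient_projP/asboolP Hp : tensor_proj p = tensor_proj p' by rewrite px.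
have /quotient_projP/asboolP Hq : tensor_proj q = tensor_proj q' by rewrite qy.
apply/quotient_projP/asboolP.
have -> : \val (r - r') =
    1 *: ((\val p - \val p') * \val q) + \val p' * (\val q - \val q').
  rewrite -[\val (r - r')]/(\val r - \val r') rE r'E scale1r mulrBl mulrBr.
  by rewrite addrA subrK.
have /subspaceP[_ SD] : subspace (span multilinear_relators).
  exact: smallest_subspace.
apply: SD.
- exact: (span_multilinearM _ Hp).2.
- exact: (span_multilinearM _ Hq).1.
Qed.

End TensorAlgebra.

Arguments tensor_top {K V} top.
Arguments tensor_mul {K V} top.

Section Enveloping.
Context {K : fieldType} {g : lmodType K}.
Context (top : g -> g -> Prop) (br : g -> g -> g).

(* a (x) b - b (x) a - [a, b] *)
Definition enveloping_relators : set (tensor_algebra top) :=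
  [set z | exists a b ab ba,
     [/\ top a b,
         tensor_mul top (tensor_incl top a) (tensor_incl top b) ab,
         tensor_mul top (tensor_incl top b) (tensor_incl top a) ba
       & z = ab - ba - tensor_incl top (br a b)]].

Definition enveloping_ideal : set (tensor_algebra top) :=
  smallest (is_prelocality_ideal (tensor_top top) (tensor_mul top))
           enveloping_relators.

Definition in_enveloping_ideal : {pred tensor_algebra top} :=
  [in enveloping_ideal].

Fact in_enveloping_ideal_closed : submod_closed in_enveloping_ideal.
Proof. by apply: smallest_subspace => S []. Qed.

HB.instance Definition _ := GRing.isSubmodClosed.Build K (tensor_algebra top)
  in_enveloping_ideal in_enveloping_ideal_closed.

Definition enveloping : lmodType K := quotient_space in_enveloping_ideal.

Definition enveloping_proj (x : tensor_algebra top) : enveloping :=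
  quotient_proj in_enveloping_ideal x.

Definition enveloping_top : enveloping -> enveloping -> Prop :=
  quotient_top (tensor_top top) enveloping_proj.

(* A relation rather than a function: a pre-locality ideal J absorbs products
   with elements of its polar only, which does not by itself force the class of
   a (x) b to depend only on the classes of a and b. *)
Definition enveloping_mul : enveloping -> enveloping -> enveloping -> Prop :=
  quotient_mul (tensor_mul top) enveloping_proj.

Definition enveloping_unit (k : K) : enveloping :=
  enveloping_proj (tensor_unit top k).

Definition enveloping_incl (x : g) : enveloping :=
  enveloping_proj (tensor_incl top x).

End Enveloping.

Arguments enveloping_top {K g} top br.
Arguments enveloping_mul {K g} top br.
Arguments enveloping_unit {K g} top br.
Arguments enveloping_incl {K g} top br.

(* Main.v *)
Require Import Defs.
From mathcomp Require Import all_boot all_algebra finmap.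
From mathcomp Require Import boolp classical_sets reals.
From mathcomp Require Import monalg.

(** The hypotheses on [A] are much stronger than they look.  The unit is
    independent of everything, so the locality of the product applies to the
    pairs [(a, 1)] and [(1, b)] and says that [a = a 1] and [b = 1 b] are
    independent, for all [a] and [b] ([unital_locality_total]).  Hence [A] is an
    ordinary associative unital algebra, and the classical argument goes through.

    Existence: sending a word [x1 ... xn] to [f x1 ... f xn] extends linearly to a
    multiplicative map on the free algebra of all words on [g].  It kills the
    multilinear relators, hence descends to the tensor algebra; there its kernel
    is an ideal containing the relators [a (x) b - b (x) a - [a, b]], hence
    containing the ideal they generate, so it descends to the enveloping algebra.

    Uniqueness: a local word [x :: s] is the product of the independent elements
    [x] and [s], so a morphism is determined on words, which span, by its values
    on the letters ([enveloping_morphism_uniq]). *)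

Set Implicit Arguments.
Unset Strict Implicit.
Unset Printing Implicit Defensive.

Import GRing.Theory.

Local Open Scope classical_set_scope.
Local Open Scope ring_scope.

(** * Linear maps out of free spaces and quotients *)

Section LinearMaps.
Context {K : fieldType}.

Lemma linear_map0 (V W : lmodType K) (h : V -> W) : linear h -> h 0 = 0.
Proof. by move=> /(_ (-1) 0 0); rewrite scaler0 addr0 scaleN1r addNr. Qed.

Lemma linear_mapD (V W : lmodType K) (h : V -> W) :
  linear h -> forall a b, h (a + b) = h a + h b.
Proof. by move=> hL a b; have := hL 1 a b; rewrite !scale1r. Qed.

Lemma linear_mapZ (V W : lmodType K) (h : V -> W) :
  linear h -> forall k a, h (k *: a) = k *: h a.
Proof. by move=> hL k a; have := hL k a 0; rewrite (linear_map0 hL) !addr0. Qed.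

Lemma linear_mapB (V W : lmodType K) (h : V -> W) :
  linear h -> forall a b, h (a - b) = h a - h b.
Proof.
by move=> hL a b; rewrite linear_mapD // -[in LHS]scaleN1r linear_mapZ // scaleN1r.
Qed.

Lemma span_kernel (V W : lmodType K) (h : V -> W) (G : set V) :
  linear h -> (forall x, G x -> h x = 0) -> forall x, Defs.span G x -> h x = 0.
Proof.
move=> hL hG x; suff sub : Defs.span G `<=` [set y | h y = 0] by exact: sub.
apply: smallest_sub => //; apply/subspaceP; split=> [|k u v /= hu hv].
  exact: linear_map0.
by rewrite hL hu hv scaler0 addr0.
Qed.

Section FreeSpace.
Context {X : choiceType} {V : lmodType K} (h : X -> V).

Lemma linear_extension_wide (d : {fset X}) (p : {malg K[X]}) :
  (msupp p `<=` d)%fset ->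
  linear_extension h p = \sum_(x <- d) p@_x *: h x.
Proof.
move=> sub; apply: big_fset_incl => // x _ /mcoeff_outdom ->.
by rewrite scale0r.
Qed.

Lemma linear_extension_linear : linear (linear_extension h).
Proof.
move=> k p q; pose d := (msupp p `|` msupp q `|` msupp (k *: p + q))%fset.
have sub (r : {fset X}) : r \in [:: msupp p; msupp q; msupp (k *: p + q)] ->
    (r `<=` d)%fset.
  rewrite !inE => rE; apply/fsubsetP => x; rewrite !in_fsetU.
  by case/or3P: rE => /eqP-> ->; rewrite ?orbT.
rewrite !(@linear_extension_wide d) ?sub ?inE ?eqxx ?orbT //.
rewrite scaler_sumr -big_split /=; apply: eq_bigr => x _.
by rewrite mcoeffD mcoeffZ scalerDl scalerA.
Qed.

Lemma linear_extensionU x : linear_extension h << x >> = h x.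
Proof.
rewrite (@linear_extension_wide [fset x]%fset) ?msuppU_le //.
by rewrite big_seq_fset1 mcoeffUU scale1r.
Qed.

End FreeSpace.

Section QuotientLift.
Context {V W : lmodType K} (S : submodClosed V) (h : V -> W).

(** The value at a chosen representative; it is the map induced by [h] when [h] is
    linear and kills [S]. *)
Definition quotient_lift (x : quotient_space S) : W :=
  h (repr (x : Quotient.quot (as_zmod S))).

Hypothesis h_linear : linear h.
Hypothesis h_kills : forall x, x \in S -> h x = 0.

Lemma quotient_lift_proj x : quotient_lift (quotient_proj S x) = h x.
Proof.
apply/subr0_eq; rewrite /quotient_lift -linear_mapB //; apply: h_kills; apply/quotient_projP.
by rewrite /quotient_proj reprK.
Qed.

Lemma quotient_proj_linear : linear (quotient_proj S).
Proof. by move=> k x y; rewrite quotient_projD -quotient_projZ. Qed.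

Lemma quotient_lift_linear : linear quotient_lift.
Proof.
move=> k x y; have [a <-] := quotient_proj_surj x.
have [b <-] := quotient_proj_surj y.
by rewrite -quotient_proj_linear !quotient_lift_proj h_linear.
Qed.

End QuotientLift.
End LinearMaps.

(** * The target is an ordinary algebra *)

Section Target.
Context {K : fieldType} {A : lmodType K} {top : A -> A -> Prop}.
Context {m : A -> A -> A} {u : K -> A}.
Hypothesis algA : is_prelocality_algebra top m u.
Hypothesis locm : locality_product top top m.

(** Independence is compared factor by factor, so padding with units on opposite
    sides compares [a] only with [1] and [b] only with [1]. *)
Lemma unital_locality_total a b : top a b.
Proof.
have [[top_sym _] _ _ _ top1 mul1l mul1r] := algA.
have -> : a = m a (u 1) by rewrite mul1r scale1r.
have -> : b = m (u 1) b by rewrite mul1l scale1r.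
have a1 : top a (u 1) by apply/top_sym/top1.
have b1 : top (u 1) b by exact: top1.
exact: locm.
Qed.

(** Since every pair is independent, the bilinear relators themselves are
    supported on independent pairs, so they can be tested against [m]. *)
Lemma total_relator p : @bilinear_relators K A p ->
  linear_extension (fun ab : (A * A)%type => m ab.1 ab.2) p = 0.
Proof.
move=> Gp; apply: (prealg_bilinear algA).
  exact: sub_gen_smallest.
by move=> ab _; exact: unital_locality_total.
Qed.

Lemma total_mul_linearl x : linear (m^~ x).
Proof.
pose eL := linear_extension_linear (fun ab : (A * A)%type => m ab.1 ab.2).
have mD a b : m (a + b) x = m a x + m b x.
  have /total_relator : @bilinear_relators K A
      (<< (a + b, x) >> - << (a, x) >> - << (b, x) >>).
    by constructor 1; exists a, b, x.
  rewrite !(linear_mapB eL) !linear_extensionU /= => /subr0_eq.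
  by move=> /(canRL (subrK _)) ->; exact: addrC.
have mZ k a : m (k *: a) x = k *: m a x.
  have /total_relator : @bilinear_relators K A
      (<< (k *: a, x) >> - k *: << (a, x) >>).
    by constructor 3; exists k, a, x.
  by rewrite (linear_mapB eL) (linear_mapZ eL) !linear_extensionU /= => /subr0_eq.
by move=> k a b; rewrite mD mZ.
Qed.

Lemma total_mul_linearr x : linear (m x).
Proof.
pose eL := linear_extension_linear (fun ab : (A * A)%type => m ab.1 ab.2).
have mD a b : m x (a + b) = m x a + m x b.
  have /total_relator : @bilinear_relators K A
      (<< (x, a + b) >> - << (x, a) >> - << (x, b) >>).
    by constructor 2; exists x, a, b.
  rewrite !(linear_mapB eL) !linear_extensionU /= => /subr0_eq.
  by move=> /(canRL (subrK _)) ->; exact: addrC.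
have mZ k a : m x (k *: a) = k *: m x a.
  have /total_relator : @bilinear_relators K A
      (<< (x, k *: a) >> - k *: << (x, a) >>).
    by constructor 4; exists k, x, a.
  by rewrite (linear_mapB eL) (linear_mapZ eL) !linear_extensionU /= => /subr0_eq.
by move=> k a b; rewrite mD mZ.
Qed.

Lemma total_mulA x y z : m (m x y) z = m x (m y z).
Proof. by apply: (prealg_assoc algA); exact: unital_locality_total. Qed.

(** * Evaluation of words and of tensors *)

Section Evaluation.
Context {V : lmodType K} {topV : V -> V -> Prop} {f : V -> A}.
Hypothesis f_linear : linear f.

Definition word_value (s : seq V) : A := foldr (fun x a => m (f x) a) (u 1) s.

Definition words_value (p : {malg K[{fmonom V}]}) : A :=
  linear_extension (fun w : {fmonom V} => word_value w) p.

Lemma word_value_cat s t : word_value (s ++ t) = m (word_value s) (word_value t).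
Proof.
elim: s => [|x s IH] /=; first by rewrite (prealg_mul1l algA) scale1r.
by rewrite IH total_mulA.
Qed.

Lemma word_value_linear s t : linear (fun x => word_value (s ++ x :: t)).
Proof.
move=> k a b; rewrite !word_value_cat /= f_linear.
by rewrite total_mul_linearl total_mul_linearr.
Qed.

Lemma words_value_linear : linear words_value.
Proof. exact: linear_extension_linear. Qed.

Lemma words_value_word s : words_value (word s) = word_value s.
Proof. exact: linear_extensionU. Qed.

Lemma words_valueM p q : words_value (p * q) = m (words_value p) (words_value q).
Proof.
have vL := words_value_linear.
elim/(@malg_ind K {fmonom V}): p => [|k [s] p IHp].
  by rewrite mul0r (linear_map0 vL) (linear_map0 (total_mul_linearl _)).
rewrite mulrDl -scalerAl !vL IHp total_mul_linearl; congr (_ *: _ + _).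
elim/(@malg_ind K {fmonom V}): q {IHp} => [|c [t] q IHq].
  by rewrite mulr0 (linear_map0 vL) (linear_map0 (total_mul_linearr _)).
rewrite mulrDr -malg_scalerAr !vL IHq total_mul_linearr; congr (_ *: _ + _).
by rewrite -!/(word _) wordM !words_value_word word_value_cat.
Qed.

(** Each relator changes a single letter, and the value of a word is linear in
    each letter. *)
Lemma words_value_multilinear p :
  Defs.span (@multilinear_relators K V) p -> words_value p = 0.
Proof.
have vL := words_value_linear; apply: span_kernel => // {}p.
case=> [[s][t][a][b]|[s][t][k][a]] ->; rewrite !(linear_mapB vL) ?(linear_mapZ vL).
  rewrite !words_value_word (linear_mapD (word_value_linear s t)).
  by rewrite addrAC addrK subrr.
by rewrite !words_value_word (linear_mapZ (word_value_linear s t)) subrr.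
Qed.

Definition tensor_value : tensor_algebra topV -> A :=
  quotient_lift (fun p : local_words topV => words_value (\val p)).

Fact local_value_linear :
  linear (fun p : local_words topV => words_value (\val p)).
Proof. by move=> k p q; rewrite -words_value_linear. Qed.

Lemma tensor_value_proj p : tensor_value (tensor_proj p) = words_value (\val p).
Proof.
apply: quotient_lift_proj; first exact: local_value_linear.
by move=> x /asboolP; exact: words_value_multilinear.
Qed.

Lemma tensor_value_linear : linear tensor_value.
Proof.
apply: quotient_lift_linear; first exact: local_value_linear.
by move=> x /asboolP; exact: words_value_multilinear.
Qed.

Lemma tensor_value_mul x y z :
  tensor_mul topV x y z -> tensor_value z = m (tensor_value x) (tensor_value y).
Proof.
move=> [p [q [r [<- <- <- [_ rE]]]]].
by rewrite !tensor_value_proj rE words_valueM.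
Qed.

Lemma tensor_value_unit k : tensor_value (tensor_unit topV k) = u k.
Proof.
rewrite (linear_mapZ tensor_value_linear) tensor_value_proj words_value_word /=.
by rewrite -(linear_mapZ (prealg_unit_linear algA)) [_ *: _]mulr1.
Qed.

Lemma tensor_value_incl x : tensor_value (tensor_incl topV x) = f x.
Proof.
rewrite tensor_value_proj words_value_word /=.
by rewrite (prealg_mul1r algA) scale1r.
Qed.

(** The kernel of a multiplicative map absorbs products with every element, in
    particular with those of its polar, so it contains the generated ideal as
    soon as it contains the generators. *)
Lemma tensor_value_enveloping_ideal (br : V -> V -> V) :
  (forall x y, topV x y -> f (br x y) = commutator m (f x) (f y)) ->
  forall x, enveloping_ideal br x -> tensor_value x = 0.
Proof.
move=> f_br x; have vL := tensor_value_linear.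
suff sub : enveloping_ideal br `<=` [set y | tensor_value y = 0] by exact: sub.
apply: smallest_sub; first split.
- apply/subspaceP; split=> [|k a b /= a0 b0]; first exact: linear_map0.
  by rewrite vL a0 b0 scaler0 addr0.
- move=> a b c /= a0 _ [] /tensor_value_mul ->; rewrite a0.
    exact: (linear_map0 (total_mul_linearl _)).
  exact: (linear_map0 (total_mul_linearr _)).
move=> _ [a [b [ab [ba [ab_top /tensor_value_mul abE /tensor_value_mul baE ->]]]]].
rewrite /= !(linear_mapB vL) abE baE !tensor_value_incl f_br //.
exact: subrr.
Qed.

Definition enveloping_value (br : V -> V -> V) : @enveloping K V topV br -> A :=
  quotient_lift tensor_value.

Lemma enveloping_value_morphism (br : V -> V -> V) :
  (forall x y, topV x y -> f (br x y) = commutator m (f x) (f y)) ->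
  is_prelocality_algebra_morphism
    (enveloping_top topV br) (enveloping_mul topV br) (enveloping_unit topV br)
    top (product_graph top m) u (@enveloping_value br) /\
  f = (fun x => enveloping_value (enveloping_incl topV br x)).
Proof.
move=> f_br.
have kills x : x \in @in_enveloping_ideal K V topV br -> tensor_value x = 0.
  by move=> /set_mem; exact: tensor_value_enveloping_ideal.
have proj x : enveloping_value (enveloping_proj br x) = tensor_value x.
  exact: (quotient_lift_proj tensor_value_linear kills).
split; first split.
- exact: (quotient_lift_linear tensor_value_linear kills).
- by move=> x y _; exact: unital_locality_total.
- move=> _ _ _ [a [b [c [<- <- <- abc]]]]; split; first exact: unital_locality_total.
  by rewrite !proj; exact: tensor_value_mul.
- by move=> k; rewrite proj tensor_value_unit.
by apply: funext => x; rewrite proj tensor_value_incl.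
Qed.

End Evaluation.
End Target.

(** * The enveloping algebra is generated by the Lie algebra *)

Section Generation.
Context {K : fieldType} {V : lmodType K} {top : V -> V -> Prop}.

Lemma tensor_proj_linear : linear (@tensor_proj K V top).
Proof. exact: quotient_proj_linear. Qed.

(** The words occurring in a local element are local, so it is the combination of
    its own monomials inside the space of local elements. *)
Lemma tensor_algebra_spanned (P : tensor_algebra top -> Prop) :
  P 0 -> (forall k x y, P x -> P y -> P (k *: x + y)) ->
  (forall s (Hs : independent_tuple top s), P (tensor_proj (local_word Hs))) ->
  forall x, P x.
Proof.
move=> P0 PD Pw x; have [p <-] := quotient_proj_surj x.
have /asboolP Fp := valP p.
have loc w : w \in msupp (\val p) -> independent_tuple top w by exact: Fp.
suff [q Pq qE] : exists2 q : local_words top, P (tensor_proj q) &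
    \val q = \sum_(w <- msupp (\val p)) << (\val p)@_w *g w >>.
  by have <- : q = p by apply: val_inj; rewrite qE -monalgE.
have sub : {subset (msupp (\val p) : seq _) <= msupp (\val p)} by [].
elim: (enum_fset _) sub => [|w r IH] sub.
  exists 0; last by rewrite big_nil.
  by rewrite (linear_map0 tensor_proj_linear).
have [q Pq qE] : exists2 q : local_words top, P (tensor_proj q) &
    \val q = \sum_(w <- r) << (\val p)@_w *g w >>.
  by apply: IH => v rv; apply: sub; rewrite inE rv orbT.
have Hw : independent_tuple top w by apply: loc; apply: sub; rewrite inE eqxx.
exists ((\val p)@_w *: local_word Hw + q).
  by rewrite tensor_proj_linear; apply: PD.
rewrite big_cons -qE -[LHS]/((\val p)@_w *: word w + \val q); congr (_ + _).
have -> : word w = << w >> :> {malg K[{fmonom V}]} by case: (w).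
by apply/malgP => v; rewrite mcoeffZ !mcoeffU mulrnAr mulr1.
Qed.

Lemma independent_tuple_cons x s : independent_tuple top (x :: s) ->
  independent_tuple top s /\ forall y, y \in s -> top x y.
Proof.
move=> H; split=> [i j si sj ij|y /(nthP 0)[j js <-]].
  by apply: (H i.+1 j.+1) => // -[].
exact: (H 0%N j.+1).
Qed.

(** Pairwise independence of the letters of [x :: s] is what makes the words [x]
    and [s] independent, so the concatenation is an instance of the product. *)
Lemma tensor_mul_cons x s (Hxs : independent_tuple top (x :: s))
    (Hs : independent_tuple top s) :
  tensor_mul top (tensor_incl top x) (tensor_proj (local_word Hs))
    (tensor_proj (local_word Hxs)).
Proof.
have [_ xs] := independent_tuple_cons Hxs.
exists (local_word (@independent_tuple1 K V top x)), (local_word Hs).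
exists (local_word Hxs); split=> //; split; last by rewrite /= wordM.
move=> v w /(fsubsetP msuppU_le) + /(fsubsetP msuppU_le).
by rewrite !in_fset1 => /eqP-> /eqP-> a b; rewrite inE => /eqP->; exact: xs.
Qed.

Context {A : lmodType K} {topA : A -> A -> Prop} {m : A -> A -> A} {u : K -> A}.
Context {br : V -> V -> V}.

(** Both morphisms send the word [x :: s] to the product of the values of [x] and
    [s], so induction on the length of words reduces to letters. *)
Lemma enveloping_morphism_uniq (phi psi : @enveloping K V top br -> A) :
  is_prelocality_algebra_morphism
    (enveloping_top top br) (enveloping_mul top br) (enveloping_unit top br)
    topA (product_graph topA m) u phi ->
  is_prelocality_algebra_morphism
    (enveloping_top top br) (enveloping_mul top br) (enveloping_unit top br)
    topA (product_graph topA m) u psi ->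
  (forall x, phi (enveloping_incl top br x) = psi (enveloping_incl top br x)) ->
  phi =1 psi.
Proof.
move=> [phiL _ phiM phi1] [psiL _ psiM psi1] eq_incl z.
have [x <-] := quotient_proj_surj z.
have piL : linear (@enveloping_proj K V top br) by exact: quotient_proj_linear.
rewrite -/(enveloping_proj br x).
elim/tensor_algebra_spanned: x => [|k x y IHx IHy|].
- by rewrite (linear_map0 piL) (linear_map0 phiL) (linear_map0 psiL).
- by rewrite piL phiL psiL IHx IHy.
elim=> [|x s IH] Hs.
  have -> : tensor_proj (local_word Hs) = tensor_unit top 1.
    by rewrite /tensor_unit scale1r; congr tensor_proj; exact: val_inj.
  by rewrite phi1 psi1.
have [Hs' _] := independent_tuple_cons Hs.
have xsM : enveloping_mul top br (enveloping_incl top br x)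
    (enveloping_proj br (tensor_proj (local_word Hs')))
    (enveloping_proj br (tensor_proj (local_word Hs))).
  exists (tensor_incl top x), (tensor_proj (local_word Hs')).
  by exists (tensor_proj (local_word Hs)); split=> //; exact: tensor_mul_cons.
have [_ ->] := phiM _ _ _ xsM; have [_ ->] := psiM _ _ _ xsM.
by rewrite eq_incl IH.
Qed.

End Generation.

(** * The universal property *)

Theorem theorem4p22 (R : realType) (k : base_field)
  (g : lmodType (scalars R k)) (topg : g -> g -> Prop) (br : g -> g -> g)
  (A : lmodType (scalars R k)) (topA : A -> A -> Prop)
  (mA : A -> A -> A) (uA : scalars R k -> A) (f : g -> A) :
  is_prelocality_lie topg br ->
  is_prelocality_algebra topA mA uA ->
  locality_product topA topA mA ->
  is_prelocality_lie_morphism topg br topA (commutator mA) f ->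
  exists! phi : enveloping topg br -> A,
    is_prelocality_algebra_morphism
      (enveloping_top topg br) (enveloping_mul topg br) (enveloping_unit topg br)
      topA (product_graph topA mA) uA phi /\
    f = (fun x => phi (enveloping_incl topg br x)).
Proof.
move=> _ algA locm [f_linear _ f_br].
have [mor fE] := enveloping_value_morphism algA locm f_linear f_br.
exists (@enveloping_value _ _ mA uA _ topg f br); split=> // psi [psi_mor psiE].
apply: funext; apply: (enveloping_morphism_uniq mor psi_mor) => x.
by rewrite -[LHS](congr1 (fun h => h x) fE) -[RHS](congr1 (fun h => h x) psiE).
Qed.
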